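(* Let $G$ be a group that is the union of two proper subsemigroups. Then there exists a minimum normal subgroup $N\unlhd G$ for which $G/N$ is left-orderable and nontrivial; that is, there is a normal subgroup $N\unlhd G$ such that $G/N$ is left-orderable and nontrivial, and $N\subseteq M$ for every normal subgroup $M\unlhd G$ such that $G/M$ is left-orderable and nontrivial.
   Context: A subsemigroup of a group $G$ is a subset of $G$ closed under the multiplication of $G$ (it need not contain the identity or inverses); it is proper if it is not equal to $G$. A group $G$ is left-orderable if there is a total order $\leq$ on $G$ such that for all $g_1,g_2,h\in G$: $g_1\leq g_2$ if and only if $hg_1\leq hg_2$. *)

(* Defs.v *)
From HB Require Import structures.
From mathcomp Require Import all_boot.
From mathcomp Require Import boolp classical_sets.

Set Implicit Arguments.
Unset Strict Implicit.
Unset Printing Implicit Defensive.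

Local Open Scope classical_set_scope.
Local Open Scope group_scope.
Local Open Scope quotient_scope.

(* The empty set counts as a subsemigroup; this is harmless for unions of two
   proper subsemigroups, since the other one would then be the whole group. *)
Definition proper_subsemigroup (G : groupType) (A : set G) : Prop :=
  mulg_closed [in A] /\ A <> [set: G].

Record normalSubgroup (G : groupType) := NormalSubgroup {
  normal_set :> set G;
  normal_group_closed : group_closed [in normal_set];
  normal_conj : forall x y : G, x \in normal_set -> x ^ y \in normal_set
}.

Section Quotient.
Variables (G : groupType) (N : normalSubgroup G).

(* x N = y N *)
Definition coset_rel : rel G := fun x y => x^-1 * y \in normal_set N.

Let N1 : 1 \in normal_set N.
Proof. by case: (normal_group_closed N). Qed.

Let NV x : x \in normal_set N -> x^-1 \in normal_set N.
Proof. exact: (group_closedV (normal_group_closed N)). Qed.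

Let NM x y : x \in normal_set N -> y \in normal_set N ->
  x * y \in normal_set N.
Proof. exact: (group_closedM (normal_group_closed N)). Qed.

Fact coset_rel_refl : reflexive coset_rel.
Proof. by move=> x; rewrite /coset_rel mulVg. Qed.

Fact coset_rel_sym : symmetric coset_rel.
Proof.
have h x y : coset_rel x y -> coset_rel y x.
  by move=> /NV; rewrite invgM invgK.
by move=> x y; apply/idP/idP; apply: h.
Qed.

Fact coset_rel_trans : transitive coset_rel.
Proof. by move=> y x z xy /(NM xy); rewrite mulgA mulgK. Qed.

Canonical coset_equiv := EquivRel coset_rel
  coset_rel_refl coset_rel_sym coset_rel_trans.

Definition quotient_group := {eq_quot coset_equiv}.

HB.instance Definition _ := Choice.on quotient_group.
HB.instance Definition _ := EqQuotient.on quotient_group.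

Definition coset_proj (x : G) : quotient_group := \pi_quotient_group x.
Definition coset_mul (u v : quotient_group) : quotient_group :=
  coset_proj (repr u * repr v).
Definition coset_inv (u : quotient_group) : quotient_group :=
  coset_proj (repr u)^-1.

Lemma coset_projP x y : coset_proj x = coset_proj y <-> coset_rel x y.
Proof. by split=> [/eqquotP|h]//; apply/eqquotP. Qed.

Lemma coset_projK (u : quotient_group) : coset_proj (repr u) = u.
Proof. exact: reprK. Qed.

Lemma coset_projW (P : quotient_group -> Prop) :
  (forall x, P (coset_proj x)) -> forall u, P u.
Proof. by move=> h u; rewrite -(coset_projK u). Qed.

Fact coset_projM x y :
  coset_mul (coset_proj x) (coset_proj y) = coset_proj (x * y).
Proof.
apply/coset_projP.
have /coset_projP := coset_projK (coset_proj x).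
have /coset_projP := coset_projK (coset_proj y).
rewrite /coset_rel; move: (repr (coset_proj x)) (repr (coset_proj y)).
move=> a b bN aN.
have -> : (a * b)^-1 * (x * y) = ((b^-1 * y) * ((a^-1 * x) ^ y)).
  by rewrite conjgE invgM !mulgA mulgK.
by rewrite NM// normal_conj.
Qed.

Fact coset_projV x : coset_inv (coset_proj x) = coset_proj x^-1.
Proof.
apply/coset_projP; have /coset_projP := coset_projK (coset_proj x).
rewrite /coset_rel; move: (repr (coset_proj x)) => a aN.
have -> : a^-1^-1 * x^-1 = (a^-1 * x)^-1 ^ a^-1.
  by rewrite conjgE !invgM !invgK !mulgA mulgK.
by rewrite normal_conj// NV.
Qed.

Fact coset_mulA : associative coset_mul.
Proof.
by do 3!elim/coset_projW=> ?; rewrite !coset_projM mulgA.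
Qed.

Fact coset_mul1 : left_id (coset_proj 1) coset_mul.
Proof. by elim/coset_projW=> x; rewrite coset_projM mul1g. Qed.

Fact coset_mulr1 : right_id (coset_proj 1) coset_mul.
Proof. by elim/coset_projW=> x; rewrite coset_projM mulg1. Qed.

Fact coset_mulV : left_inverse (coset_proj 1) coset_inv coset_mul.
Proof. by elim/coset_projW=> x; rewrite coset_projV coset_projM mulVg. Qed.

Fact coset_mulrV : right_inverse (coset_proj 1) coset_inv coset_mul.
Proof. by elim/coset_projW=> x; rewrite coset_projV coset_projM mulgV. Qed.

HB.instance Definition _ := isGroup.Build quotient_group
  coset_mulA coset_mul1 coset_mulr1 coset_mulV coset_mulrV.

Fact coset_proj_morph : {morph coset_proj : x y / x / y}.
Proof. by move=> x y; rewrite -coset_projM -coset_projV. Qed.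

HB.instance Definition _ :=
  isGroupMorphism.Build G quotient_group coset_proj coset_proj_morph.

End Quotient.

Definition left_orderable (G : groupType) : Prop :=
  exists le : rel G,
    [/\ reflexive le, antisymmetric le, transitive le, total le
      & forall g1 g2 h : G, le g1 g2 <-> le (h * g1) (h * g2)].

Definition nontrivial (G : groupType) : Prop := exists g : G, g <> 1.

(* Main.v *)
Require Import Defs.
From mathcomp Require Import all_boot.
From mathcomp Require Import boolp classical_sets.

Local Open Scope classical_set_scope.

(** Call a subsemigroup [S] of [G] total if [S] and [S^-1] cover [G].  If [G] is
    the union of the proper subsemigroups [A] and [B], one of them is total:
    otherwise choose [x, x^-1] outside [A] and [y, y^-1] outside [B]; neither
    [A] nor [B] can contain [x y].  The quotient [G / N] is left-orderable iff
    [N] is the intersection of [S] and [S^-1] for a total subsemigroup [S].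
    Let [N] be the intersection of all total subsemigroups, a normal subgroup
    contained in every [M] with [G / M] left-orderable.  By Zorn's lemma there
    is an inclusion-minimal total subsemigroup [S].  For any other one [T], the
    elements of [S] that are in [T] or not in [S^-1] again form a total
    subsemigroup (the order of [S], refined by [T]), so by minimality the
    intersection of [S] and [S^-1] lies in [T]; hence it is [N]. *)

Section TotalSubsemigroups.
Local Open Scope group_scope.
Set Implicit Arguments.
Unset Strict Implicit.
Variable G : groupType.
Implicit Types (x y g : G) (A B S T : set G) (N M : normalSubgroup G).

Definition total_subsemigroup S : Prop :=
  (forall x y, S x -> S y -> S (x * y)) /\ (forall x, S x \/ S x^-1).

Lemma total_subsemigroup1 S : total_subsemigroup S -> S 1.
Proof. by move=> [_ /(_ 1)]; rewrite invg1 => -[]. Qed.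

(** Invariance under inversion and conjugation is what makes the intersection of all total
    subsemigroups a normal subgroup. *)
Lemma total_subsemigroupV S :
  total_subsemigroup S -> total_subsemigroup [set x | S x^-1].
Proof.
move=> [SM St]; split=> [x y Sx Sy|x] /=; last exact: St x^-1.
by rewrite invgM; apply: SM.
Qed.

Lemma total_subsemigroupJ S g :
  total_subsemigroup S -> total_subsemigroup [set x | S (x ^ g)].
Proof.
move=> [SM St]; split=> [x y Sx Sy|x] /=; first by rewrite conjMg; apply: SM.
by rewrite conjVg; apply: St.
Qed.

(** For closure: if [x], [y] and [(x * y)^-1] lie in [S], then so do [x^-1 = y * (x * y)^-1] and
    [y^-1 = (x * y)^-1 * x], whence [x] and [y] lie in [T]. *)
Lemma total_subsemigroup_refine S T :
  total_subsemigroup S -> total_subsemigroup T ->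
  total_subsemigroup [set x | S x /\ (S x^-1 -> T x)].
Proof.
move=> [SM St] [TM Tt]; split=> [x y [Sx Tx] [Sy Ty]|x] /=.
  split=> [|Sxy]; first exact: SM.
  apply: TM.
    by apply: Tx; have := SM _ _ Sy Sxy; rewrite invgM mulVKg.
  by apply: Ty; have := SM _ _ Sxy Sx; rewrite invgM mulgVK.
rewrite invgK.
have [Sx|nSx] := pselect (S x); last by right; have [|] := St x.
have [SVx|nSVx] := pselect (S x^-1); last by left.
by have [Tx|TVx] := Tt x; [left|right].
Qed.

(** If one member of the chain omits [x] and another omits [x^-1], the smaller of the two omits
    both, against totality. *)
Lemma total_subsemigroup_bigcap (F : set (set G)) :
  F `<=` total_subsemigroup -> total_on F subset ->
  total_subsemigroup (\bigcap_(S in F) S).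
Proof.
move=> Fts Ftot; split=> [x y Fx Fy S FS|x].
  by have [SM _] := Fts _ FS; apply: SM; [apply: Fx|apply: Fy].
apply: contrapT => /not_orP[/existsNP[S /not_implyP[FS nSx]]].
move=> /existsNP[T /not_implyP[FT nTx]].
by case: (Ftot _ _ FS FT) => ST;
  [case: (Fts _ FS) => _ /(_ x)[//|/ST]|case: (Fts _ FT) => _ /(_ x)[/ST|]].
Qed.

Lemma minimal_total_subsemigroup :
  exists S, total_subsemigroup S /\
    forall T, total_subsemigroup T -> T `<=` S -> S `<=` T.
Proof.
(* This form of Zorn's lemma gives maximal sets from unions of chains, so it is applied to
   complements. *)
have [|U [Uts Umax]] := @Zorn_bigcup G [set X | total_subsemigroup (~` X)].
  move=> F Fts Ftot /=; rewrite setC_bigcup.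
  rewrite -(bigcap_image F setC id).
  apply: total_subsemigroup_bigcap => [_ [X FX <-]|_ _ [X FX <-] [Y FY <-]].
    exact: Fts.
  by case: (Ftot _ _ FX FY) => XY; [right|left]; move=> x; apply: contra_not => /XY.
exists (~` U); split=> // T Tts TU.
apply: contrapT => nUT; apply: (Umax (~` T)); last by rewrite /= setCK.
split=> [x Ux Tx|UT]; first exact: TU Tx Ux.
by apply: nUT => x; apply: contra_notP => /UT.
Qed.

Definition total_subsemigroup_core : set G :=
  [set x | forall S, total_subsemigroup S -> S x].

Lemma total_subsemigroup_core_group :
  group_closed [in total_subsemigroup_core].
Proof.
split=> [|x y]; first by rewrite inE => S /total_subsemigroup1.
rewrite !inE => Nx Ny S Sts; have [SM _] := Sts; apply: SM; first exact: Nx.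
exact: Ny (total_subsemigroupV Sts).
Qed.

Lemma total_subsemigroup_core_conj x y :
  x \in total_subsemigroup_core -> x ^ y \in total_subsemigroup_core.
Proof. by rewrite !inE => Nx S /(total_subsemigroupJ y)/Nx. Qed.

Definition total_subsemigroup_radical : normalSubgroup G :=
  NormalSubgroup total_subsemigroup_core_group total_subsemigroup_core_conj.

Lemma minimal_total_subsemigroup_core S :
  total_subsemigroup S ->
  (forall T, total_subsemigroup T -> T `<=` S -> S `<=` T) ->
  forall x, S x -> S x^-1 -> total_subsemigroup_core x.
Proof.
move=> Sts Smin x Sx SVx T Tts.
have [|_ /(_ SVx)//] := Smin _ (total_subsemigroup_refine Sts Tts) _ x Sx.
by move=> y [].
Qed.

Lemma coset_proj1 N : coset_proj N 1 = 1.
Proof. exact: gmulf1. Qed.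

Lemma coset_proj_eq1 N x : coset_proj N x = 1 <-> normal_set N x.
Proof.
rewrite -(coset_proj1 N); split=> [/esym/coset_projP|Nx].
  by rewrite /coset_rel invg1 mul1g inE.
by apply/esym/coset_projP; rewrite /coset_rel invg1 mul1g inE.
Qed.

Lemma left_orderable_quotient N S :
  total_subsemigroup S -> N `<=` S ->
  (forall x, S x -> S x^-1 -> normal_set N x) ->
  left_orderable (quotient_group N).
Proof.
move=> Sts NS SN; have [SM St] := Sts.
pose P (u : quotient_group N) := S (repr u).
(* As [N] lies in [S], the set [S] is a union of cosets of [N], so the choice of representative does
   not matter. *)
have PE x : P (coset_proj N x) <-> S x.
  have /coset_projP := coset_projK (coset_proj N x).
  rewrite /coset_rel inE /P; set y := repr _ => Nyx.
  have Nxy : normal_set N (x^-1 * y).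
    have := @group_closedV _ _ (normal_group_closed N) (y^-1 * x).
    by rewrite !inE invgM invgK; apply.
  by split=> [/SM/(_ (NS _ Nyx))|/SM/(_ (NS _ Nxy))]; rewrite mulVKg.
exists (fun u v => `[< P (u^-1 * v) >]); split.
- move=> u; apply/asboolP; rewrite mulVg -(coset_proj1 N).
  by apply/PE; exact: total_subsemigroup1 Sts.
- elim/coset_projW=> x; elim/coset_projW=> y.
  rewrite -!gmulfV -!gmulfM => /andP[/asboolP/PE Sxy /asboolP/PE Syx].
  apply/coset_projP; rewrite /coset_rel inE; apply: SN => //.
  by rewrite invgM invgK.
- elim/coset_projW=> y; elim/coset_projW=> x; elim/coset_projW=> z.
  rewrite -!gmulfV -!gmulfM => /asboolP/PE Sxy /asboolP/PE Syz.
  by apply/asboolP/PE; have := SM _ _ Sxy Syz; rewrite mulgA mulgK.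
- elim/coset_projW=> x; elim/coset_projW=> y.
  rewrite -!gmulfV -!gmulfM; apply/orP.
  have [/PE ?|] := St (x^-1 * y); first by left; apply/asboolP.
  by rewrite invgM invgK => /PE ?; right; apply/asboolP.
- by move=> u v w; rewrite invgM mulgA mulgVK.
Qed.

(** Take the preimage of the elements above [1] in the quotient; antisymmetry of the order gives the
    second claim. *)
Lemma total_subsemigroup_of_order M :
  left_orderable (quotient_group M) ->
  exists S, total_subsemigroup S /\ forall x, S x -> S x^-1 -> normal_set M x.
Proof.
move=> [le [_ le_anti le_trans le_total leM]].
exists [set x | le 1 (coset_proj M x)]; split; first split=> [x y|x] /=.
- move=> lex ley; rewrite gmulfM; apply: (le_trans (coset_proj M x)) => //.
  by rewrite -[X in le X]mulg1 -leM.
- have /orP[|lex1] := le_total 1 (coset_proj M x); first by left.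
  by right; rewrite gmulfV (leM _ _ (coset_proj M x)) mulg1 mulgV.
move=> x /= lex; rewrite gmulfV => /(leM _ _ (coset_proj M x)).
rewrite mulg1 mulgV => lex1; apply/coset_proj_eq1/le_anti.
by rewrite lex1.
Qed.

Lemma total_subsemigroup_of_cover A B :
  mulg_closed [in A] -> mulg_closed [in B] -> A `|` B = [set: G] ->
  total_subsemigroup A \/ total_subsemigroup B.
Proof.
move=> AM BM AB.
have {}AM x y : A x -> A y -> A (x * y).
  by have := AM x y; rewrite !inE.
have {}BM x y : B x -> B y -> B (x * y).
  by have := BM x y; rewrite !inE.
have {}AB x : A x \/ B x by have : [set: G] x by []; rewrite -AB.
apply: contrapT => /not_orP[nA nB].
have /existsNP[x /not_orP[nAx nAVx]] : ~ forall x, A x \/ A x^-1.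
  by move=> At; apply: nA.
have /existsNP[y /not_orP[nBy nBVy]] : ~ forall y, B y \/ B y^-1.
  by move=> Bt; apply: nB.
(* In [A], cancel [y^-1], which is in [A] since it is not in [B]; in [B], cancel [x^-1] likewise. *)
have [Axy|Bxy] := AB (x * y).
  by have [Ay|//] := AB y^-1; apply: nAx; rewrite -(mulgK y x); apply: AM.
by have [//|Bx] := AB x^-1; apply: nBy; rewrite -(mulKg x y); apply: BM.
Qed.

End TotalSubsemigroups.

Theorem mainTheorem2 (G : groupType) :
  (exists A B : set G,
    [/\ proper_subsemigroup A, proper_subsemigroup B & A `|` B = [set: G]]) ->
  exists N : normalSubgroup G,
    [/\ left_orderable (quotient_group N),
        nontrivial (quotient_group N)
      & forall M : normalSubgroup G,
          left_orderable (quotient_group M) ->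
          nontrivial (quotient_group M) ->
          N `<=` M].
Proof.
move=> [A [B [[AM AnT] [BM BnT] AB]]].
exists (total_subsemigroup_radical G); split.
- have [S [Sts Smin]] := minimal_total_subsemigroup G.
  apply: (left_orderable_quotient Sts) => [x /(_ S Sts)//|].
  exact: minimal_total_subsemigroup_core Sts Smin.
(* An element outside a proper total subsemigroup is outside the radical, so its coset is
   nontrivial. *)
- have [T [Tts TnT]] : exists T : set G, total_subsemigroup T /\ T <> setT.
    by case: (total_subsemigroup_of_cover AM BM AB) => ?;
      [exists A|exists B].
  have [g nTg] : exists g, ~ T g.
    by apply/existsNP => Tall; apply: TnT; apply/seteqP; split.
  by exists (coset_proj _ g) => /coset_proj_eq1/(_ T Tts).
- move=> M /total_subsemigroup_of_order[S [Sts SM]] _ x Nx.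
  by apply: SM; [exact: Nx|exact: Nx _ (total_subsemigroupV Sts)].
Qed.
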